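(* For the explicit finite-difference scheme given in the context, the following discrete balance equations for the mass, kinetic and internal energies of the mixture are valid on $\omega_h\times\check{\omega}^{\Delta t}$: $$\delta_t\rho+\delta^*j=0,\qquad j:=[\rho]([u]-w),$$ $$\tfrac12\delta_t(\rho u^2)-\tfrac{\Delta t}{2}\hat{\rho}(\delta_tu)^2+\tfrac12\delta^*(ju_-u_+)+(\delta^*[p])u=(\delta^*\Pi)u,$$ $$\delta_t(\rho\varepsilon)+\tfrac{\Delta t}{2}\hat{\rho}(\delta_tu)^2+\delta^*(j[\varepsilon])=-\delta^*q+[\Pi\delta u]^*-p\,\delta^*([u]-w)+[w\delta p]^*+[Q]^*.$$
   Context: One-dimensional case, body force absent. Meshes: $\bar\omega_h=\{x_i=-X+ih;\ 0\le i\le N\}$ and $\omega_h^*=\{x_{i+1/2}=-X+(i+0.5)h;\ 0\le i\le N-1\}$ on $[-X,X]$, $h=2X/N$, $\omega_h=\bar\omega_h\setminus\{-X,X\}$; time mesh $\bar\omega^{\Delta t}=\{0=t_0<t_1<\dots<t_{\overline m}=t_{fin}\}$ with steps $\Delta t_m=t_{m+1}-t_m$ (written $\Delta t$ at level $m$), $\check\omega^{\Delta t}=\bar\omega^{\Delta t}\setminus\{t_{fin}\}$. For $v$ on $\bar\omega_h$, $z$ on $\omega_h^*$ and $y$ on $\bar\omega^{\Delta t}$: $$[v]_{i+1/2}=\tfrac12(v_i+v_{i+1}),\quad (\delta v)_{i+1/2}=\frac{v_{i+1}-v_i}{h},\quad [z]^*_i=\tfrac12(z_{i-1/2}+z_{i+1/2}),\quad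 (\delta^*z)_i=\frac{z_{i+1/2}-z_{i-1/2}}{h},\quad \delta_ty^m=\frac{y^{m+1}-y^m}{\Delta t_m},$$ $v_{-,i+1/2}=v_i$, $v_{+,i+1/2}=v_{i+1}$, $\hat y^m=y^{m+1}$. $\langle\cdot\rangle$ denotes summation over $k=1,2$. Unknowns on $\bar\omega_h\times\bar\omega^{\Delta t}$: $\rho_1>0,\rho_2>0$ (densities of the components), $u$ (velocity), $\varepsilon$ (specific internal energy of the mixture), with $\rho=\langle\rho_k\rangle$. The explicit two-level in time scheme on $\omega_h\times\check\omega^{\Delta t}$ is (all terms outside $\delta_t$ taken at the lower time level) $$\delta_t\rho_k+\delta^*\big([\rho_k]([u]-w_k)\big)=0,\ k=1,2,$$ $$\delta_t(\rho u)+\delta^*\big([\rho]([u]-w)[u]+[p]\big)=\delta^*\Pi,$$ $$\delta_t\big(\tfrac12\rho u^2+\rho\varepsilon\big)+\delta^*\big\{\big(\tfrac12[\rho]u_-u_++[\rho\varepsilon]+[p]\big)([u]-w)-\tfrac14h^2(\delta p)\delta u\big\}=\delta^*(-q+\Pi[u])+[Q]^*.$$ Here $$w_k=\frac{[\tau]}{[\rho_k]}[u]\delta(\rho_ku)+\widehat w,\quad \widehat w=\frac{[\tau]}{[\rho]}([\rho][u]\delta u+\delta p),\quad w=\Big\langle\frac{[\rho_k]}{[\rho]}w_k\Big\rangle=\frac{[\tau]}{[\rho]}[u]\delta(\rho u)+\widehat w,$$ $$\Pi=\nu\delta u+[u][\rho]\widehat w+[\tau]\Big([u]\delta p+[\rho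 c_s^2]\delta u-\frac{[c_s^2]}{[\gamma c_V][\theta]}Q\Big),$$ $$-q=\varkappa\delta\theta+[\tau]\Big\{\Big(\delta(\rho\varepsilon)-\frac{[\rho\varepsilon]+[p]}{[\rho]}\delta\rho\Big)[u]^2-Q[u]\Big\}.$$ $w_k,\widehat w,w,\Pi,q,\nu,\varkappa,Q$ are defined on $\omega_h^*\times\bar\omega^{\Delta t}$; $Q\ge0$ is the given heat source intensity. The functions $p,\theta,\tau,c_s^2$ on $\bar\omega_h\times\bar\omega^{\Delta t}$ are as follows. With constants $c_{Vk}>0$, $\gamma_k>1$, $R_k=(\gamma_k-1)c_{Vk}$, $p_{*k}\ge0$, $\varepsilon_{0k}$ put $\rho\varepsilon_0=\langle\rho_k\varepsilon_{0k}\rangle$, $\rho c_V=\langle c_{Vk}\rho_k\rangle$, $\rho R=\langle R_k\rho_k\rangle$, $\gamma=R/c_V+1$, $\sigma^{(k)}=R_k\rho_k/(c_V\rho)$, $b=\langle\sigma^{(k)}(\rho(\varepsilon-\varepsilon_0)-p_{*k})-p_{*k}\rangle$, $c=(\sigma^{(1)}p_{*2}+\sigma^{(2)}p_{*1})\rho(\varepsilon-\varepsilon_0)-\gamma p_{*1}p_{*2}$, $d=b^2+4c$; then $p=\tfrac12(b+\sqrt d)$, $\theta=\langle R_k\rho_k/(p+p_{*k})\rangle^{-1}$, $c_s^2=\gamma(p+p_{*1})(p+p_{*2})/(\rho\sqrt d)$, and $$\tau=\frac{ah}{c_s+i_\tau|u|},\quad \nu=a_S[\tau][p],\quad \varkappa=a_{Pr}[\tau][c_p][p],$$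 with parameters $a>0$, $a_S\ge0$, $a_{Pr}>0$, $i_\tau\in\{0,1\}$ and $\rho c_p=\langle\gamma_kc_{Vk}\rho_k\rangle$.
   Formalization: The third balance fails with [ρε] in the energy flux, so two corrected forms are proved: for the printed scheme, with [ρε]([u]−w) in place of j[ε]; and as printed, with j[ε], for the scheme whose energy flux has [ρ][ε] in place of [ρε]. *)

(* Defs.v *)
(* MathComp world, over an arbitrary real closed field (for Num.sqrt).

   Encoding of the meshes.  A function v on the nodes x_0, ..., x_N is a
   function nat -> R, v i being v_i; a function z on the half-integer nodes is
   also a function nat -> R, z i being z_{i+1/2} (0 <= i <= N-1).  Hence the
   half-nodes adjacent to the interior node x_i are i.-1 and i.  A function y on
   the time mesh is a function nat -> R, y m being y^m.  Equations are only
   imposed, and only asserted, where every index is in range. *)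
From HB Require Import structures.
From mathcomp Require Import all_boot all_order all_algebra.
Set Implicit Arguments.
Unset Strict Implicit.
Unset Printing Implicit Defensive.
Import Order.TTheory GRing.Theory Num.Theory.
Local Open Scope ring_scope.

Section MeshOperators.
Context {R : fieldType}.
Implicit Types (h : R) (t v y z : nat -> R) (i m : nat).

(* [v]_{i+1/2}, (delta v)_{i+1/2}, v_{-,i+1/2}, v_{+,i+1/2} *)
Definition avg v i : R := (v i + v i.+1) / 2%:R.
Definition dif h v i : R := (v i.+1 - v i) / h.
Definition lft v i : R := v i.
Definition rgt v i : R := v i.+1.

(* [z]^*_i and (delta^* z)_i *)
Definition avgs z i : R := (z i.-1 + z i) / 2%:R.
Definition difs h z i : R := (z i - z i.-1) / h.

Definition tstep t m : R := t m.+1 - t m.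
Definition dt t y m : R := (y m.+1 - y m) / tstep t m.

End MeshOperators.

Definition mesh_step {R : fieldType} (X : R) (N : nat) : R := 2%:R * X / N%:R.

Definition time_mesh {R : numDomainType} (t : nat -> R) (mbar : nat) (tfin : R)
    : Prop :=
  [/\ t 0%N = 0, t mbar = tfin
    & forall m : nat, (m < mbar)%N -> t m < t m.+1].

(* Components are indexed by 'I_2, i.e. k = 1, 2 become k1, k2. *)
Definition k1 : 'I_2 := ord0.
Definition k2 : 'I_2 := ord_max.

Record params (R : Type) := Params {
  cV    : 'I_2 -> R;   (* c_{Vk} *)
  gam   : 'I_2 -> R;   (* gamma_k *)
  pstar : 'I_2 -> R;   (* p_{*k} *)
  eps0  : 'I_2 -> R;   (* epsilon_{0k} *)
  acoef : R;           (* a *)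
  aS    : R;
  aPr   : R;
  itau  : bool         (* i_tau in {0,1} *)
}.

Definition admissible {R : numDomainType} (P : params R) : Prop :=
  (forall k, [/\ 0 < cV P k, 1 < gam P k & 0 <= pstar P k]) /\
  [/\ 0 < acoef P, 0 <= aS P & 0 < aPr P].

(* The unknowns at one time level. *)
Record state (R : Type) := State {
  dens : 'I_2 -> nat -> R;   (* rho_k *)
  vel  : nat -> R;           (* u *)
  eps  : nat -> R            (* epsilon *)
}.

Section Scheme.
Context {R : rcfType} (P : params R) (h : R).
Implicit Types (s : state R) (Q : nat -> R) (k : 'I_2) (i : nat).

(* ---- Functions on the nodes ---- *)

Definition rho s i : R := \sum_(k < 2) dens s k i.

Definition Rgas k : R := (gam P k - 1) * cV P k.

Definition eps0mix s i : R := (\sum_(k < 2) dens s k i * eps0 P k) / rho s i.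
Definition cVmix s i : R := (\sum_(k < 2) cV P k * dens s k i) / rho s i.
Definition Rmix s i : R := (\sum_(k < 2) Rgas k * dens s k i) / rho s i.
Definition cpmix s i : R :=
  (\sum_(k < 2) gam P k * cV P k * dens s k i) / rho s i.
Definition gammix s i : R := Rmix s i / cVmix s i + 1.
Definition sigma s k i : R := Rgas k * dens s k i / (cVmix s i * rho s i).

Definition bcoef s i : R :=
  \sum_(k < 2)
    (sigma s k i * (rho s i * (eps s i - eps0mix s i) - pstar P k)
     - pstar P k).
Definition ccoef s i : R :=
  (sigma s k1 i * pstar P k2 + sigma s k2 i * pstar P k1)
    * (rho s i * (eps s i - eps0mix s i))
  - gammix s i * pstar P k1 * pstar P k2.
Definition disc s i : R := bcoef s i ^+ 2 + 4%:R * ccoef s i.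

Definition pres s i : R := (bcoef s i + Num.sqrt (disc s i)) / 2%:R.
Definition theta s i : R :=
  (\sum_(k < 2) Rgas k * dens s k i / (pres s i + pstar P k))^-1.
Definition cs2 s i : R :=
  gammix s i * (pres s i + pstar P k1) * (pres s i + pstar P k2)
  / (rho s i * Num.sqrt (disc s i)).
Definition tau s i : R :=
  acoef P * h / (Num.sqrt (cs2 s i) + (itau P)%:R * `|vel s i|).

Definition rhou s i : R := rho s i * vel s i.
Definition rhou2 s i : R := rho s i * vel s i ^+ 2.
Definition rhoeps s i : R := rho s i * eps s i.

(* ---- Functions on the half-integer nodes ---- *)

Definition nu s i : R := aS P * avg (tau s) i * avg (pres s) i.
Definition kappa s i : R :=
  aPr P * avg (tau s) i * avg (cpmix s) i * avg (pres s) i.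

Definition what s i : R :=
  avg (tau s) i / avg (rho s) i
  * (avg (rho s) i * avg (vel s) i * dif h (vel s) i + dif h (pres s) i).
Definition wk s k i : R :=
  avg (tau s) i / avg (dens s k) i * avg (vel s) i
    * dif h (fun l => dens s k l * vel s l) i
  + what s i.
Definition w s i : R :=
  \sum_(k < 2) avg (dens s k) i / avg (rho s) i * wk s k i.

Definition Pi s Q i : R :=
  nu s i * dif h (vel s) i
  + avg (vel s) i * avg (rho s) i * what s i
  + avg (tau s) i
    * (avg (vel s) i * dif h (pres s) i
       + avg (fun l => rho s l * cs2 s l) i * dif h (vel s) i
       - avg (cs2 s) i
         / (avg (fun l => gammix s l * cVmix s l) i * avg (theta s) i) * Q i).

Definition q s Q i : R :=
  - (kappa s i * dif h (theta s) i
     + avg (tau s) i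
       * ((dif h (rhoeps s) i
           - (avg (rhoeps s) i + avg (pres s) i) / avg (rho s) i
             * dif h (rho s) i) * avg (vel s) i ^+ 2
          - Q i * avg (vel s) i)).

(* The regularized velocity [u] - w, and j = [rho]([u] - w). *)
Definition regvel s i : R := avg (vel s) i - w s i.
Definition j s i : R := avg (rho s) i * regvel s i.

(* The two half-node averages of rho * epsilon, [rho epsilon] and
   [rho][epsilon]; they differ by (h^2/4) (delta rho) (delta epsilon).  Used in
   the energy flux, the first yields the internal energy flux
   [rho epsilon]([u] - w) = j [rho epsilon]/[rho], the second yields
   j [epsilon]. *)
Definition avg_rhoeps s i : R := avg (rhoeps s) i.
Definition avg_rho_avg_eps s i : R := avg (rho s) i * avg (eps s) i.

(* ---- Difference equations at the node x_i between levels m and m+1 ---- *)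

Section Equations.
Context (t : nat -> R) (Q : nat -> nat -> R) (s : nat -> state R).

Definition component_mass_eq k i m : Prop :=
  dt t (fun n => dens (s n) k i) m
  + difs h (fun l => avg (dens (s m) k) l * (avg (vel (s m)) l - wk (s m) k l)) i
  = 0.

Definition momentum_eq i m : Prop :=
  dt t (fun n => rhou (s n) i) m
  + difs h (fun l => avg (rho (s m)) l * regvel (s m) l * avg (vel (s m)) l
                     + avg (pres (s m)) l) i
  = difs h (Pi (s m) (Q m)) i.

(* E is the half-node average of rho * epsilon used in the convective flux. *)
Definition energy_eq (E : state R -> nat -> R) i m : Prop :=
  dt t (fun n => rhou2 (s n) i / 2%:R + rhoeps (s n) i) m
  + difs h (fun l =>
      (avg (rho (s m)) l * lft (vel (s m)) l * rgt (vel (s m)) l / 2%:R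
       + E (s m) l + avg (pres (s m)) l) * regvel (s m) l
      - h ^+ 2 / 4%:R * dif h (pres (s m)) l * dif h (vel (s m)) l) i
  = difs h (fun l => - q (s m) (Q m) l
                     + Pi (s m) (Q m) l * avg (vel (s m)) l) i
    + avgs (Q m) i.

Definition explicit_scheme (E : state R -> nat -> R) (N mbar : nat) : Prop :=
  forall m i : nat, (m < mbar)%N -> (0 < i < N)%N ->
    [/\ forall k, component_mass_eq k i m, momentum_eq i m & energy_eq E i m].

Definition mass_balance i m : Prop :=
  dt t (fun n => rho (s n) i) m + difs h (j (s m)) i = 0.

Definition kinetic_balance i m : Prop :=
  dt t (fun n => rhou2 (s n) i) m / 2%:R
  - tstep t m / 2%:R * rho (s m.+1) i * dt t (fun n => vel (s n) i) m ^+ 2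
  + difs h (fun l => j (s m) l * lft (vel (s m)) l * rgt (vel (s m)) l) i
    / 2%:R
  + difs h (avg (pres (s m))) i * vel (s m) i
  = difs h (Pi (s m) (Q m)) i * vel (s m) i.

(* F is the convective flux of the internal energy. *)
Definition internal_balance (F : state R -> nat -> R) i m : Prop :=
  dt t (fun n => rhoeps (s n) i) m
  + tstep t m / 2%:R * rho (s m.+1) i * dt t (fun n => vel (s n) i) m ^+ 2
  + difs h (F (s m)) i
  = - difs h (q (s m) (Q m)) i
    + avgs (fun l => Pi (s m) (Q m) l * dif h (vel (s m)) l) i
    - pres (s m) i * difs h (regvel (s m)) i
    + avgs (fun l => w (s m) l * dif h (pres (s m)) l) i
    + avgs (Q m) i.

End Equations.

End Scheme.

(* Main.v *)
Require Import Defs.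
From HB Require Import structures.
From mathcomp Require Import all_boot all_order all_algebra.
From mathcomp Require Import ring lra.
Set Implicit Arguments.
Unset Strict Implicit.
Unset Printing Implicit Defensive.
Import Order.TTheory GRing.Theory Num.Theory.
Local Open Scope ring_scope.

(** The three balances are linear combinations of the equations of the scheme,
    once discrete product rules are available.

    Mass: summing the component equations gives the balance, because [w] is by
    definition the mean of the [wk] weighted by the half-node component
    densities; the component fluxes therefore add up to [j] (lemma [sum_component_flux]).

    Kinetic energy: it is the momentum equation multiplied by [u], minus the
    mass balance multiplied by [u^2 / 2].  In time, [u dt(rho u)] differs from
    [dt(rho u^2) / 2 + u^2 dt(rho) / 2] by the term quadratic in [dt u], since
    [u] is taken at the lower level (lemma [dt_kinetic]).  In space, the mean
    of [u] in the momentum flux produces exactly the product [u_- u_+] of the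
    kinetic energy flux (lemma [difs_kinetic_flux]).

    Internal energy: it is the total energy equation minus the kinetic balance.
    The viscous work splits by the product rule (lemma [difs_mul_avg]).  The
    pressure work splits in the same way (lemma [difs_pressure_work]): the
    correction [h^2 (delta p)(delta u) / 4] in the scheme turns the
    product of the means of [p] and [u] into the mean of the cross products
    [p_- u_+] and [p_+ u_-], whose difference obeys the Leibniz rule without
    remainder.

    The convective flux of internal energy passes unchanged from the total
    energy equation to the internal energy balance, so both means of
    [rho * eps] are covered by one argument in which that mean is a variable
    [E] (lemma [scheme_balances]).  *)

(** * Discrete product rules *)

Section ProductRules.
Variable R : numFieldType.
Implicit Types (h : R) (t r v z p u x : nat -> R) (i m : nat).

Lemma eq_difs h z1 z2 i : z1 =1 z2 -> difs h z1 i = difs h z2 i.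
Proof. by move=> eqz; rewrite /difs !eqz. Qed.

Lemma difsD h z1 z2 i :
  difs h (fun l => z1 l + z2 l) i = difs h z1 i + difs h z2 i.
Proof. by rewrite /difs; ring. Qed.

Lemma difsN h z i : difs h (fun l => - z l) i = - difs h z i.
Proof. by rewrite /difs; ring. Qed.

Lemma difs_half h z i :
  difs h (fun l => z l / 2%:R) i = difs h z i / 2%:R.
Proof. by rewrite /difs; ring. Qed.

Lemma difs_sum h n (z : 'I_n -> nat -> R) i :
  difs h (fun l => \sum_k z k l) i = \sum_k difs h (z k) i.
Proof. by rewrite /difs -sumrB mulr_suml. Qed.

Lemma dtD t y1 y2 m : dt t (fun n => y1 n + y2 n) m = dt t y1 m + dt t y2 m.
Proof. by rewrite /dt; ring. Qed.

Lemma dt_half t y m : dt t (fun n => y n / 2%:R) m = dt t y m / 2%:R.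
Proof. by rewrite /dt; ring. Qed.

Lemma dt_sum t n (y : 'I_n -> nat -> R) m :
  dt t (fun l => \sum_k y k l) m = \sum_k dt t (y k) m.
Proof. by rewrite /dt -sumrB mulr_suml. Qed.

(** At both half-nodes next to [x_i], the mean [v] differs from [v i] by half
    an increment of [v], outwards; the two increments make up the mean of
    [z delta v]. *)
Lemma difs_mul_avg h z v i : h != 0 -> (0 < i)%N ->
  difs h (fun l => z l * avg v l) i
  = difs h z i * v i + avgs (fun l => z l * dif h v l) i.
Proof.
by case: i => // i h0 _; rewrite /difs /avgs /avg /dif /=; field.
Qed.

(** The product [v i * avg v] is half the sum of [v i ^+ 2] and of the product
    of the two neighbouring values; this holds at each of the two half-nodes. *)
Lemma difs_kinetic_flux h z v i : (0 < i)%N ->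
  difs h (fun l => z l * avg v l) i * v i
  = v i ^+ 2 / 2%:R * difs h z i
    + difs h (fun l => z l * lft v l * rgt v l) i / 2%:R.
Proof.
case: i => // i _; rewrite /difs /avg /lft /rgt /=.
(* The inverse of [h] is a common factor, whatever [h] is. *)
by set c := h^-1; field.
Qed.

(** With the correction, [avg p * avg u] becomes
    [(p_- u_+ + p_+ u_-) / 2], in which the value at [x_i] of one factor always
    meets the outer value of the other; the part carried by [x] obeys the
    product rule of [difs_mul_avg]. *)
Lemma difs_pressure_work h p u x i : h != 0 -> (0 < i)%N ->
  difs h (fun l => avg p l * (avg u l - x l)
                   - h ^+ 2 / 4%:R * dif h p l * dif h u l) i
  = difs h (avg p) i * u i + p i * difs h (fun l => avg u l - x l) i
    - avgs (fun l => x l * dif h p l) i.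
Proof.
by case: i => // i h0 _; rewrite /difs /avgs /avg /dif /=; field.
Qed.

(** The remainder comes from
    [u^m u^{m+1} = ((u^m)^2 + (u^{m+1})^2 - (u^{m+1} - u^m)^2) / 2]. *)
Lemma dt_kinetic t r u m : tstep t m != 0 ->
  dt t (fun n => r n * u n) m * u m
  = dt t (fun n => r n * u n ^+ 2) m / 2%:R
    - tstep t m / 2%:R * r m.+1 * dt t u m ^+ 2
    + u m ^+ 2 / 2%:R * dt t r m.
Proof. by move=> t0; rewrite /dt; field. Qed.

End ProductRules.

(** * Balances of the scheme *)

Section Balances.
Variables (R : rcfType) (P : params R) (h : R).
Variables (t : nat -> R) (Q : nat -> nat -> R) (s : nat -> state R).
Implicit Types (E : state R -> nat -> R) (i l m : nat).

Lemma avg_rhoE (r : state R) l : avg (rho r) l = \sum_(k < 2) avg (dens r k) l.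
Proof. by rewrite /avg /rho -big_split mulr_suml. Qed.

(** The weights [avg rho_k / avg rho] in [w] are the shares of the components in the
    total mass, so the diffusive fluxes [avg rho_k * wk] add up to [avg rho * w]. *)
Lemma sum_component_flux (r : state R) l : avg (rho r) l != 0 ->
  \sum_(k < 2) avg (dens r k) l * (avg (vel r) l - wk P h r k l) = j P h r l.
Proof.
move=> rho0; rewrite /j /regvel /w mulrBr mulr_sumr {1}avg_rhoE mulr_suml -sumrB.
apply: eq_bigr => k _.
by rewrite mulrBr [avg (rho r) l * _]mulrA [avg (rho r) l * _]mulrC divfK.
Qed.

Lemma mass_balance_of_components i m :
    avg (rho (s m)) i.-1 != 0 -> avg (rho (s m)) i != 0 ->
    (forall k, component_mass_eq P h t s k i m) ->
  mass_balance P h t s i m.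
Proof.
move=> rhol rhor comp; rewrite /mass_balance.
have -> : difs h (j P h (s m)) i = difs h (fun l =>
    \sum_(k < 2) avg (dens (s m) k) l * (avg (vel (s m)) l - wk P h (s m) k l)) i.
  by rewrite /difs !sum_component_flux.
rewrite /rho dt_sum difs_sum -big_split /=.
by apply: big1 => k _; apply: comp.
Qed.

Lemma kinetic_balance_of_momentum i m : tstep t m != 0 -> (0 < i)%N ->
    mass_balance P h t s i m -> momentum_eq P h t Q s i m ->
  kinetic_balance P h t Q s i m.
Proof.
move=> t0 i0 mass; rewrite /momentum_eq /kinetic_balance difsD => <-.
rewrite [RHS]mulrDl [(_ + _) * vel _ _]mulrDl dt_kinetic //.
rewrite (difs_kinetic_flux _ (j P h (s m))) //.
have -> : dt t (fun n => rho (s n) i) m = - difs h (j P h (s m)) i.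
  by apply/eqP; rewrite -addr_eq0; apply/eqP.
by rewrite /rhou2; ring.
Qed.

(** The total energy flux, split into the fluxes of kinetic energy and internal
    energy and the work of the pressure. *)
Lemma difs_energy_flux E i m : h != 0 -> (0 < i)%N ->
  difs h (fun l =>
      (avg (rho (s m)) l * lft (vel (s m)) l * rgt (vel (s m)) l / 2%:R
       + E (s m) l + avg (pres P (s m)) l) * regvel P h (s m) l
      - h ^+ 2 / 4%:R * dif h (pres P (s m)) l * dif h (vel (s m)) l) i
  = difs h (fun l => j P h (s m) l * lft (vel (s m)) l * rgt (vel (s m)) l) i
      / 2%:R
    + difs h (fun l => E (s m) l * regvel P h (s m) l) i
    + (difs h (avg (pres P (s m))) i * vel (s m) i
       + pres P (s m) i * difs h (regvel P h (s m)) i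
       - avgs (fun l => w P h (s m) l * dif h (pres P (s m)) l) i).
Proof.
move=> h0 i0; rewrite -difs_pressure_work // -difs_half -!difsD.
by apply: eq_difs => l; rewrite /j /regvel; ring.
Qed.

Lemma internal_balance_of_energy E i m : h != 0 -> (0 < i)%N ->
    kinetic_balance P h t Q s i m -> energy_eq P h t Q s E i m ->
  internal_balance P h t Q s (fun r l => E r l * regvel P h r l) i m.
Proof.
move=> h0 i0; rewrite /kinetic_balance /energy_eq /internal_balance.
rewrite difs_energy_flux // dtD dt_half.
rewrite (difsD _ (fun l => - q P h (s m) (Q m) l)) difsN difs_mul_avg //.
lra.
Qed.

End Balances.

Section SchemeBalances.
Variables (R : rcfType) (P : params R) (h : R) (N mbar : nat).
Variables (t : nat -> R) (Q : nat -> nat -> R) (s : nat -> state R).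
Hypothesis h0 : h != 0.
Hypothesis t_incr : forall m, (m < mbar)%N -> t m < t m.+1.
Hypothesis dens_gt0 : forall (k : 'I_2) (m i : nat),
  (m <= mbar)%N -> (i <= N)%N -> 0 < dens (s m) k i.

Lemma avg_rho_gt0 m l : (m <= mbar)%N -> (l < N)%N -> 0 < avg (rho (s m)) l.
Proof.
move=> lem ltl; rewrite avg_rhoE big_ord_recl big_ord1.
by rewrite addr_gt0 // divr_gt0 // addr_gt0 // dens_gt0 // ltnW.
Qed.

Lemma scheme_balances (E : state R -> nat -> R) :
    explicit_scheme P h t Q s E N mbar ->
  forall m i, (m < mbar)%N -> (0 < i < N)%N ->
    [/\ mass_balance P h t s i m,
        kinetic_balance P h t Q s i m
      & internal_balance P h t Q s (fun r l => E r l * regvel P h r l) i m].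
Proof.
move=> scheme m i ltm iN; have [comp mom en] := scheme m i ltm iN.
have /andP[i0 ltiN] := iN.
have t0 : tstep t m != 0 by rewrite subr_eq0 gt_eqF // t_incr.
have mass : mass_balance P h t s i m.
  apply: mass_balance_of_components => //; apply: lt0r_neq0;
    apply: avg_rho_gt0; rewrite ?(ltnW ltm) //.
  exact: leq_ltn_trans (leq_pred i) ltiN.
have kin : kinetic_balance P h t Q s i m.
  exact: kinetic_balance_of_momentum.
by split=> //; exact: internal_balance_of_energy.
Qed.

End SchemeBalances.

Theorem proposition9 (R : rcfType) (X tfin : R) (N mbar : nat)
  (t : nat -> R) (P : params R) (Q : nat -> nat -> R) (s : nat -> state R)
  (h := mesh_step X N)
  (hX : 0 < X) (hN : (0 < N)%N) (ht : time_mesh t mbar tfin)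
  (hP : admissible P)
  (hQ : forall m i : nat, (m <= mbar)%N -> (i < N)%N -> 0 <= Q m i)
  (hrho : forall (k : 'I_2) (m i : nat), (m <= mbar)%N -> (i <= N)%N ->
            0 < dens (s m) k i) :
  (explicit_scheme P h t Q s avg_rhoeps N mbar ->
   forall m i : nat, (m < mbar)%N -> (0 < i < N)%N ->
     [/\ mass_balance P h t s i m,
         kinetic_balance P h t Q s i m
       & internal_balance P h t Q s
           (fun r l => avg_rhoeps r l * regvel P h r l) i m])
  /\
  (explicit_scheme P h t Q s avg_rho_avg_eps N mbar ->
   forall m i : nat, (m < mbar)%N -> (0 < i < N)%N ->
     [/\ mass_balance P h t s i m,
         kinetic_balance P h t Q s i m
       & internal_balance P h t Q s
           (fun r l => j P h r l * avg (eps r) l) i m]).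
Proof.
have h0 : h != 0.
  by rewrite /h /mesh_step gt_eqF // divr_gt0 ?mulr_gt0 // ltr0n.
have [_ _ t_incr] := ht.
split=> scheme m i ltm iN.
  exact: (scheme_balances h0 t_incr hrho scheme).
have [mass kin int] := scheme_balances h0 t_incr hrho scheme ltm iN.
split=> //; move: int; rewrite /internal_balance.
(* The two expressions of the flux differ by the order of the factors. *)
rewrite (@eq_difs _ h _ (fun l => j P h (s m) l * avg (eps (s m)) l)) //.
by move=> l; rewrite /j /avg_rho_avg_eps mulrAC.
Qed.
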